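(* Let $\Sigma$ be a totally ordered alphabet with $|\Sigma| > n$, and let $\pi$ be a type 1 order with parameter $m$. Any $R$-pass deterministic streaming algorithm that, for every $x \in \Sigma^n$ given in order $\pi$, outputs a $1 + 1/32$ multiplicative approximation of $\mathrm{LIS}(x)$ needs $\Omega(m/R)$ space.
   Context: $\mathrm{LIS}(x)$ is the length of a longest strictly increasing subsequence of $x = x_1\cdots x_n$. A streaming order is a permutation $\pi = \pi_1\cdots\pi_n$ of $[n]$; in each pass the algorithm sees $x_{\pi_1}, x_{\pi_2}, \dots, x_{\pi_n}$ in that order. A permutation $\pi$ is a type 1 order with parameter $m$ if there are index sets $I = \{i_1,\dots,i_m\}$ and $J = \{j_1,\dots,j_m\}$ with $|I|=|J|=m$, $\max(I) < \min(J)$, and $1 \le \pi_{i_1} < \pi_{j_1} < \pi_{i_2} < \pi_{j_2} < \cdots < \pi_{i_m} < \pi_{j_m} < n$. Space is measured in bits. *)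

(* Defs.v *)
From mathcomp Require Import all_boot all_order all_algebra all_fingroup.

Set Implicit Arguments.
Unset Strict Implicit.
Unset Printing Implicit Defensive.

Import Order.TTheory GRing.Theory Num.Theory.
Local Open Scope ring_scope.

(* |T| > n, for T finite or infinite. *)
Definition card_gt (T : eqType) (n : nat) : Prop :=
  exists e : seq T, uniq e /\ (n < size e)%N.

(* [mask b x], for b a bit vector, ranges over the subsequences of x. *)
Definition LIS (d : Order.disp_t) (Sigma : orderType d) (n : nat)
    (x : n.-tuple Sigma) : nat :=
  \max_(b : n.-tuple bool | sorted <%O (mask b x)) size (mask b x).

(* Times and positions are 0-based: [pi t] is the position of x read at time t.
   The informal 1-based value pi_t is therefore [(pi t).+1]; in the chain
   1 <= pi_{i_1} < pi_{j_1} < ... < pi_{i_m} < pi_{j_m} < n the left end is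
   vacuous, while the right end excludes the last position of x. *)
Definition type1_order (n : nat) (pi : 'S_n) (m : nat) : Prop :=
  exists (I J : {set 'I_n}) (i j : 'I_m -> 'I_n),
    [/\ I = [set i k | k : 'I_m] /\ J = [set j k | k : 'I_m],
        #|I| = m /\ #|J| = m,
        forall a b : 'I_n, a \in I -> b \in J -> (a < b)%N
      & [/\ forall k : 'I_m, (pi (i k) < pi (j k))%N,
            forall k l : 'I_m, l = k.+1 :> nat -> (pi (j k) < pi (i l))%N
          & forall k : 'I_m, ((pi (j k)).+1 < n)%N]].

(* Deterministic R-pass algorithm with s bits of memory on streams of length n.
   The model is non-uniform: the update may depend on the pass and on the time
   within the pass (no space is charged for this), and neither the update nor
   the output map is subject to any computability restriction. *)
Record streaming_alg (K Sigma : Type) (n R s : nat) := StreamingAlg {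
  alg_init : s.-tuple bool;
  alg_step : 'I_R -> 'I_n -> s.-tuple bool -> Sigma -> s.-tuple bool;
  alg_output : s.-tuple bool -> K
}.

Section Execution.
Variables (K Sigma : Type) (n R s : nat).
Variables (A : streaming_alg K Sigma n R s) (pi : 'S_n) (x : n.-tuple Sigma).

(* [enum 'I_n] lists 0, ..., n-1 in increasing order. *)
Definition run_pass (r : 'I_R) (st : s.-tuple bool) : s.-tuple bool :=
  foldl (fun st (t : 'I_n) => alg_step A r t st (tnth x (pi t))) st (enum 'I_n).

Definition run : s.-tuple bool :=
  foldl (fun st r => run_pass r st) (alg_init A) (enum 'I_R).

Definition alg_result : K := alg_output A run.

End Execution.

(* Two-sided, hence implied by either of the one-sided conventions
   L / a <= v <= L  and  L <= v <= a * L  (for a >= 1). *)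
Definition mult_approx (K : realFieldType) (a v L : K) : Prop :=
  L / a <= v <= a * L.

(* Main.v *)
(* Two-party fooling argument. At the positions a_k = pi_{i_k} and b_k = pi_{j_k} of
   the chain put the symbols of rank 2k + [k in u] and 2k + [k in v], and a symbol of
   rank 2m everywhere else. The first half of every pass depends on u only, the second
   half on v only. Block k contributes two symbols to an increasing subsequence
   exactly when k is in v but not in u, and the last position one more, so the LIS is
   m + 1 for u = v and is at least m + 1 + |v \ u| in general.
   Let the transcript of u list the 2R memory states met on the input (u, u) at half
   passes. If u and v have the same transcript, the algorithm answers on (u, v) and on
   (v, u) as it does on (u, u); the approximation guarantee then forces
   |u \ v| + |v \ u| <= m / 4. Hence the 2^m sets u fall into at most 2^(2Rs) classes,
   each contained in a Hamming ball of radius m / 4, which has at most 3^m / 2^(3m/4)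
   elements. *)
Require Import Defs.
From mathcomp Require Import all_boot all_order all_algebra all_fingroup.
From mathcomp Require Import zify lra.

Set Implicit Arguments.
Unset Strict Implicit.
Unset Printing Implicit Defensive.

Import Order.TTheory GRing.Theory Num.Theory.

(** * Counting sets in Hamming balls *)

(** Expand the product of [1 + c] over [T]: an element in [w] picks the factor 1, one outside picks
    [c]. *)
Lemma sum_expn_cardsC (T : finType) (c : nat) :
  \sum_(w : {set T}) c ^ #|~: w| = c.+1 ^ #|T|.
Proof.
have /= := @bigA_distr _ _ 1 muln addn T (fun=> 1) (fun=> c).
rewrite prod_nat_const add1n => ->.
apply: eq_bigr => w _; rewrite -prod_nat_const big_mkcond /=.
by apply: eq_bigr => i _; rewrite inE; case: (i \in w).
Qed.

(* Each [w] in the ball has weight at least [2 ^ (#|T| - r)] in [sum_expn_cardsC]. *)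
Lemma card_hamming_ball (T : finType) (r : nat) :
  #|[set w : {set T} | #|w| <= r]| * 2 ^ (#|T| - r) <= 3 ^ #|T|.
Proof.
rewrite -sum_expn_cardsC -sum_nat_const big_mkcond /=.
apply: leq_sum => w _; rewrite inE; case: ifP => //= w_le_r.
by rewrite leq_exp2l // cardsCs setCK leq_sub2l.
Qed.

(** Symmetric difference with a fixed member of a fiber maps the fiber injectively into the ball of
    radius [r] around the empty set. *)
Lemma small_fibers_card (T U : finType) (f : {set T} -> U) (r : nat) :
    (forall u v, f u = f v -> #|u :\: v| + #|v :\: u| <= r) ->
  2 ^ #|T| * 2 ^ (#|T| - r) <= #|U| * 3 ^ #|T|.
Proof.
move=> fibP; set ball := [set w : {set T} | #|w| <= r].
suff fibers : 2 ^ #|T| <= #|U| * #|ball|.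
  apply: leq_trans (leq_mul fibers (leqnn _)) _.
  by rewrite -mulnA leq_mul2l card_hamming_ball orbT.
have <- : #|[set: {set T}]| = 2 ^ #|T| by rewrite -powersetT card_powerset cardsT.
rewrite -sum1_card (partition_big f predT) //= -sum_nat_const.
apply: leq_sum => y _; rewrite sum1dep_card.
case: (pickP [pred u | f u == y]) => [u /eqP fu | no_u]; last first.
  rewrite (_ : [set _ | _] = set0) ?cards0 //.
  by apply/setP=> w; have:= no_u w; rewrite !inE.
pose symd (v : {set T}) := (u :\: v) :|: (v :\: u).
have symd_inj : injective symd.
  move=> v w /setP eq_vw; apply/setP=> i; have:= eq_vw i; rewrite !inE.
  by case: (i \in u); case: (i \in v); case: (i \in w).
rewrite -(card_imset _ symd_inj); apply: subset_leq_card.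
apply/subsetP=> _ /imsetP[v + ->]; rewrite !inE /= => /eqP fv.
by apply: leq_trans (leq_card_setU _ _) _; apply: fibP; rewrite fu fv.
Qed.

Lemma exponent_of_ball_bound (m q : nat) :
  2 ^ m * 2 ^ (m - m %/ 4) <= 2 ^ q * 3 ^ m -> m <= 12 * q.
Proof.
rewrite -expnD => le_mq.
(* 3 <= 2 ^ (5/3), while the left-hand side is at least 2 ^ (7m/4). *)
have le27 : (3 ^ m) ^ 3 <= 2 ^ (5 * m).
  by rewrite -expnM mulnC !expnM; case: (m) => // k; rewrite leq_exp2r.
have : (2 ^ (m + (m - m %/ 4))) ^ 3 <= (2 ^ q * 3 ^ m) ^ 3 by rewrite leq_exp2r.
rewrite expnMn -!expnM in le27 * => /leq_trans/(_ (leq_mul (leqnn _) le27)).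
(* Comparing exponents, 3(2m - [m %/ 4]) <= 3q + 5m, hence m/4 <= 3q. *)
by rewrite -expnD leq_exp2l //; have := leq_divM m 4; lia.
Qed.

(** * State sequences of folds *)

(** Cut-and-paste property of protocols: from a common state, [F] and [G] reach the same next state,
    so [H], which acts as one of them, reaches it too. *)
Lemma scanl_mix (S Q : Type) (F G H : S -> Q -> S) :
    (forall q, H^~ q =1 F^~ q \/ H^~ q =1 G^~ q) ->
  forall st qs, scanl F st qs = scanl G st qs -> scanl H st qs = scanl F st qs.
Proof.
move=> mixP st qs; elim: qs st => //= q qs IH st [eq_q].
have -> : H st q = F st q by case: (mixP q) => ->.
by rewrite -eq_q => /IH ->.
Qed.

Lemma foldl_last_scanl (S Q : Type) (F : S -> Q -> S) st qs :
  foldl F st qs = last st (scanl F st qs).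
Proof. by elim: qs st => //= q qs IH st; rewrite IH. Qed.

Lemma foldl_allpairs (S P Q : Type) (F : S -> P * Q -> S) st ps qs :
  foldl F st [seq (p, q) | p <- ps, q <- qs]
    = foldl (fun st p => foldl (fun st q => F st (p, q)) st qs) st ps.
Proof.
elim: ps st => //= p ps IH st; rewrite foldl_cat IH; congr foldl.
by elim: qs st {IH} => //=.
Qed.

(** * Bounds on longest increasing subsequences *)

Section LIS.
Variables (d : Order.disp_t) (Sigma : orderType d) (n : nat).
Implicit Type x : n.-tuple Sigma.

(** A strictly increasing subsequence repeats no symbol. *)
Lemma LIS_le_size (E : seq Sigma) x :
  {subset x <= E} -> LIS x <= size E.
Proof.
move=> xE; apply/bigmax_leqP => b b_sorted.
apply: uniq_leq_size => [|z /mem_mask /xE //].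
exact: (sorted_uniq lt_trans ltxx).
Qed.

Lemma LIS_ge_card (P : {set 'I_n}) x :
    {in P &, forall p q : 'I_n, (p < q)%N -> (tnth x p < tnth x q)%O} ->
  #|P| <= LIS x.
Proof.
move=> x_homo; pose b := [tuple of [seq i \in P | i <- ord_tuple n]].
have mask_b : mask b x = [seq tnth x i | i <- enum P].
  rewrite -[in LHS](map_tnth_enum x) -map_mask /= -filter_mask enumT.
  by rewrite /enum_mem.
have sorted_P : sorted (relpre val ltn) (enum P).
  have -> : enum P = [seq i <- enum 'I_n | i \in P] by rewrite enumT.
  apply: sorted_filter => [y p q /=|]; first exact: ltn_trans.
  by rewrite -sorted_map val_enum_ord iota_ltn_sorted.
rewrite cardE -(size_map (tnth x)) -mask_b /LIS.
apply: (leq_bigmax_cond b); rewrite mask_b.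
by apply: (homo_sorted_in x_homo) sorted_P; apply/allP=> i; rewrite mem_enum.
Qed.
End LIS.

(** * The hard inputs and their LIS *)

Definition interleaved (n m : nat) (a b : 'I_m -> 'I_n) : Prop :=
  [/\ forall k, a k < b k, forall k l : 'I_m, k < l -> b k < a l
    & forall k, (b k).+1 < n].

Definition hard_index (n m : nat) (a b : 'I_m -> 'I_n) (u v : {set 'I_m})
    (p : 'I_n) : nat :=
  if [pick k | a k == p] is Some k then k.*2 + (k \in u)
  else if [pick k | b k == p] is Some k then k.*2 + (k \in v)
  else m.*2.

Section HardInstance.
Variables (n m : nat) (a b : 'I_m -> 'I_n).
Implicit Types u v : {set 'I_m}.

Lemma hard_index_le u v p : hard_index a b u v p <= m.*2.
Proof.
rewrite /hard_index; case: pickP => [k _|_].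
  by have := ltn_ord k; case: (_ \in _); lia.
by case: pickP => [k _|_] //; have := ltn_ord k; case: (_ \in _); lia.
Qed.

Lemma hard_index_alice u v v' p :
  (forall k, b k != p) -> hard_index a b u v p = hard_index a b u v' p.
Proof.
move=> b'p; rewrite /hard_index; case: pickP => // _.
by case: pickP => // k; rewrite (negPf (b'p k)).
Qed.

Lemma hard_index_bob u u' v p :
  (forall k, a k != p) -> hard_index a b u v p = hard_index a b u' v p.
Proof.
move=> a'p; rewrite /hard_index; case: pickP => // k.
by rewrite (negPf (a'p k)).
Qed.

(** For [u = v] both positions of a block carry the same rank, so at most m + 1 ranks occur. *)
Lemma hard_index_diag u p :
  hard_index a b u u p \in rcons [seq k.*2 + (k \in u) | k : 'I_m] m.*2.
Proof.
rewrite mem_rcons inE /hard_index; case: pickP => [k _|_].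
  by apply/orP; right; apply/imageP; exists k.
case: pickP => [k _|_]; last by rewrite eqxx.
by apply/orP; right; apply/imageP; exists k.
Qed.

Hypothesis ab : interleaved a b.

Let a_lt_b k : a k < b k. Proof. by case: ab. Qed.
Let b_lt_a (k l : 'I_m) : k < l -> b k < a l. Proof. by case: ab => _ + _; apply. Qed.
Let b_lt_last k : (b k).+1 < n. Proof. by case: ab. Qed.

(** This and the next three facts recover the order of blocks from that of positions, for the case
    analysis in [hard_index_increasing]. *)
Let a_lt_inv (k l : 'I_m) : a k < a l -> k < l.
Proof.
case: (ltngtP k l) => // [lt_lk|/val_inj ->]; last by rewrite ltnn.
by have := b_lt_a lt_lk; have := a_lt_b l; lia.
Qed.

Let b_lt_inv (k l : 'I_m) : b k < b l -> k < l.
Proof.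
case: (ltngtP k l) => // [lt_lk|/val_inj ->]; last by rewrite ltnn.
by have := b_lt_a lt_lk; have := a_lt_b k; lia.
Qed.

Let a_lt_b_inv (k l : 'I_m) : a k < b l -> k <= l.
Proof. by case: (leqP k l) => // /b_lt_a; lia. Qed.

Let b_lt_a_inv (k l : 'I_m) : b k < a l -> k < l.
Proof.
case: (ltngtP k l) => // [lt_lk|/val_inj ->]; last by have := a_lt_b l; lia.
by have := b_lt_a lt_lk; have := a_lt_b k; have := a_lt_b l; lia.
Qed.

Lemma interleaved_inj_a : injective a.
Proof.
move=> k l /(congr1 (@nat_of_ord n)) eq_kl; apply/val_inj.
have := a_lt_b k; have := a_lt_b l.
by case: (ltngtP k l) => // /b_lt_a; lia.
Qed.

Lemma interleaved_inj_b : injective b.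
Proof.
move=> k l /(congr1 (@nat_of_ord n)) eq_kl; apply/val_inj.
have := a_lt_b k; have := a_lt_b l.
by case: (ltngtP k l) => // /b_lt_a; lia.
Qed.

Lemma interleaved_disjoint k l : a k != b l.
Proof.
apply/eqP => eq_ab; have [lt_kl|lt_lk|/val_inj eq_kl] := ltngtP k l.
- by have := b_lt_a lt_kl; have := a_lt_b k; have := a_lt_b l; rewrite -eq_ab; lia.
- by have := b_lt_a lt_lk; rewrite eq_ab ltnn.
by have := a_lt_b l; rewrite -eq_ab eq_kl ltnn.
Qed.

(** Ranks go up to [m.*2]; this bound makes more than n symbols suffice for them. *)
Lemma interleaved_leq : m.*2 <= n.
Proof.
have sz : #|a @: setT :|: b @: setT| = m.*2.
  rewrite cardsU !card_imset ?cardsT ?card_ord; try exact: interleaved_inj_a.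
    rewrite (_ : _ :&: _ = set0) ?cards0 ?subn0 ?addnn //.
    apply/setP=> p; rewrite !inE; apply/andP=> -[/imsetP[k _ ->] /imsetP[l _ eq_ab]].
    by have := interleaved_disjoint k l; rewrite eq_ab eqxx.
  exact: interleaved_inj_b.
by rewrite -sz -[X in _ <= X]card_ord max_card.
Qed.

Lemma hard_index_a u v k : hard_index a b u v (a k) = k.*2 + (k \in u).
Proof.
rewrite /hard_index; case: pickP => [l /eqP/interleaved_inj_a -> //|].
by move/(_ k); rewrite eqxx.
Qed.

Lemma hard_index_b u v k : hard_index a b u v (b k) = k.*2 + (k \in v).
Proof.
rewrite /hard_index; case: pickP => [l|_].
  by rewrite (negPf (interleaved_disjoint l k)).
case: pickP => [l /eqP/interleaved_inj_b -> //|].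
by move/(_ k); rewrite eqxx.
Qed.

Lemma hard_index_last u v (p : 'I_n) : p.+1 = n -> hard_index a b u v p = m.*2.
Proof.
move=> p_last; rewrite /hard_index; case: pickP => [k /eqP eq_p|_].
  by have := b_lt_last k; have := a_lt_b k; move: p_last; rewrite -eq_p; lia.
case: pickP => [k /eqP eq_p|//].
by have := b_lt_last k; move: p_last; rewrite -eq_p; lia.
Qed.

(** [P] is the witness for the lower bound on LIS: one position per block, a second one for blocks
    in [v :\: u], and the last position, which has the top rank. *)
Lemma hard_index_increasing u v (z : 'I_n) : z.+1 = n ->
  let P := z |: (a @: setT :|: b @: (v :\: u)) in
  #|P| = (m + #|v :\: u|).+1 /\
  {in P &, forall p q : 'I_n, (p < q)%N -> hard_index a b u v p < hard_index a b u v q}.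
Proof.
move=> z_last P.
have a'z k : z != a k.
  by apply/eqP => eq_z; have := b_lt_last k; have := a_lt_b k; rewrite -eq_z; lia.
have b'z k : z != b k.
  by apply/eqP => eq_z; have := b_lt_last k; rewrite -eq_z; lia.
split.
  rewrite cardsU1 cardsU !card_imset ?cardsT ?card_ord;
    try exact: interleaved_inj_a; try exact: interleaved_inj_b.
  have -> : z \notin a @: setT :|: b @: (v :\: u).
    rewrite inE; apply/norP; split; apply/imsetP=> -[k _ /eqP]; exact/negP.
  rewrite (_ : _ :&: _ = set0) ?cards0 ?subn0 ?add1n //.
  apply/setP=> p; rewrite !inE; apply/andP=> -[/imsetP[k _ ->] /imsetP[l _ eq_ab]].
  by have := interleaved_disjoint k l; rewrite eq_ab eqxx.
have k2 (k : 'I_m) (c : {set 'I_m}) : k.*2 + (k \in c) < m.*2.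
  by have := ltn_ord k; case: (_ \in _); lia.
have last_max (q : 'I_n) : z < q -> False by have := ltn_ord q; lia.
move=> p q; rewrite /P !in_setU1 !in_setU => pP qP.
(* The last position [z] settles five of the nine cases; the cases aa, ab, ba, bb remain, in this
   order. *)
case/or3P: pP => [/eqP->|/imsetP[k _ ->]|/imsetP[k kP ->]];
  case/or3P: qP => [/eqP->|/imsetP[l _ ->]|/imsetP[l lP ->]];
  rewrite ?hard_index_a ?hard_index_b ?(hard_index_last _ _ z_last) //;
  try by move/last_max.
- by move/a_lt_inv; case: (_ \in _); case: (_ \in _); lia.
- move: lP; rewrite inE => /andP[/negPf l'u ->] /a_lt_b_inv.
  (* If both positions lie in one block, it is in [v] but not in [u], and the ranks are 2k and 2k +
     1. *)
  rewrite leq_eqVlt => /orP[/eqP/val_inj ->|]; first by rewrite l'u; lia.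
  by case: (_ \in _); lia.
- by move/b_lt_a_inv; case: (_ \in _); case: (_ \in _); lia.
- by move/b_lt_inv; case: (_ \in _); case: (_ \in _); lia.
Qed.
End HardInstance.

Definition hard_input (Sigma : Type) (e0 : Sigma) (e : seq Sigma) (n m : nat)
    (a b : 'I_m -> 'I_n) (u v : {set 'I_m}) : n.-tuple Sigma :=
  [tuple nth e0 e (hard_index a b u v p) | p < n].

Lemma LIS_hard_input_diag (d : Order.disp_t) (Sigma : orderType d) (e0 : Sigma)
    (e : seq Sigma) (n m : nat) (a b : 'I_m -> 'I_n) (u : {set 'I_m}) :
  LIS (hard_input e0 e a b u u) <= m.+1.
Proof.
set E := [seq nth e0 e i | i <- rcons [seq k.*2 + (k \in u) | k : 'I_m] m.*2].
have -> : m.+1 = size E by rewrite size_map size_rcons size_image card_ord.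
apply: LIS_le_size => _ /tnthP[p ->].
by rewrite tnth_mktuple map_f ?hard_index_diag.
Qed.

Lemma LIS_hard_input_ge (d : Order.disp_t) (Sigma : orderType d) (e0 : Sigma)
    (e : seq Sigma) (n m : nat) (a b : 'I_m -> 'I_n) (u v : {set 'I_m}) :
    interleaved a b -> sorted <%O e -> n < size e -> 0 < n ->
  m + #|v :\: u| < LIS (hard_input e0 e a b u v).
Proof.
move=> ab e_sorted ltne n_gt0.
have lt_z : n.-1 < n by rewrite prednK.
have z_last : (Ordinal lt_z).+1 = n by exact: prednK.
have [<- P_incr] := hard_index_increasing ab u v z_last.
apply: LIS_ge_card => p q pP qP lt_pq; rewrite !tnth_mktuple.
have idx_lt r : hard_index a b u v r < size e.
  exact: leq_ltn_trans (leq_trans (hard_index_le _ _ _ _ _) (interleaved_leq ab)) ltne.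
by rewrite (lt_sorted_ltn_nth e0 e_sorted) ?inE ?idx_lt // P_incr.
Qed.

(** * Transcripts of half passes *)

Section Run.
Variables (K Sigma : Type) (n R s : nat).
Variables (A : streaming_alg K Sigma n R s) (pi : 'S_n) (T : nat).
Implicit Types x y z : n.-tuple Sigma.

(* [q.2] selects the first half of pass [q.1], the times before [T]. *)
Definition half_pass x (st : s.-tuple bool) (q : 'I_R * bool) :=
  foldl (fun st t => alg_step A q.1 t st (tnth x (pi t))) st
    [seq t : 'I_n <- enum 'I_n | (t < T) == q.2].

(** [scanl] omits the initial state, which does not depend on the input; this leaves 2R states of s
    bits, hence at most 2^(2Rs) transcripts. *)
Definition transcript x : seq (s.-tuple bool) :=
  scanl (half_pass x) (alg_init A)
    [seq (r, h) | r <- enum 'I_R, h <- [:: true; false]].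

Lemma size_transcript x : size (transcript x) == R * 2.
Proof. by rewrite size_scanl size_allpairs -cardE card_ord. Qed.

Lemma enum_ord_split :
  enum 'I_n = [seq t : 'I_n <- enum 'I_n | (t < T) == true]
              ++ [seq t : 'I_n <- enum 'I_n | (t < T) == false].
Proof.
apply: (inj_map val_inj); rewrite map_cat val_enum_ord.
rewrite -!(filter_map val (fun t => (t < T) == _)) val_enum_ord.
(* For [T] beyond n the second half is empty. *)
case: (leqP T n) => [le_Tn|lt_nT]; last first.
  rewrite (@eq_in_filter _ _ predT) ?filter_predT; last first.
    by move=> t; rewrite mem_iota /=; lia.
  rewrite (@eq_in_filter _ _ pred0) ?filter_pred0 ?cats0 //.
  by move=> t; rewrite mem_iota /=; lia.
have -> : n = T + (n - T) by lia.
rewrite iotaD !filter_cat add0n.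
rewrite (@eq_in_filter _ _ predT (iota 0 T)) ?filter_predT; last first.
  by move=> t; rewrite mem_iota /=; lia.
rewrite (@eq_in_filter _ _ pred0 (iota T _)) ?filter_pred0; last first.
  by move=> t; rewrite mem_iota /=; lia.
rewrite (@eq_in_filter _ _ pred0 (iota 0 T)) ?filter_pred0; last first.
  by move=> t; rewrite mem_iota /=; lia.
rewrite (@eq_in_filter _ _ predT (iota T _)) ?filter_predT ?cats0 //.
by move=> t; rewrite mem_iota /=; lia.
Qed.

Lemma run_transcript x : run A pi x = last (alg_init A) (transcript x).
Proof.
rewrite /transcript -foldl_last_scanl foldl_allpairs /run.
elim: (enum 'I_R) (alg_init A) => //= r rs IH st; rewrite IH; congr foldl.
by rewrite /run_pass enum_ord_split foldl_cat.
Qed.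

(** Each half pass on [z] acts as on [x] or as on [y], so [scanl_mix] applies with half passes as
    steps. *)
Lemma alg_result_mix x y z :
    (forall t : 'I_n, t < T -> tnth z (pi t) = tnth x (pi t)) ->
    (forall t : 'I_n, T <= t -> tnth z (pi t) = tnth y (pi t)) ->
  transcript x = transcript y -> alg_result A pi z = alg_result A pi x.
Proof.
move=> eq_zx eq_zy eq_xy; rewrite /alg_result !run_transcript.
congr (alg_output _ (last _ _)); apply: scanl_mix eq_xy => -[r h].
have ext w : (forall t : 'I_n, (t < T) == h -> tnth z (pi t) = tnth w (pi t)) ->
    half_pass z ^~ (r, h) =1 half_pass w ^~ (r, h).
  move=> eq_zw st; rewrite /half_pass /=; elim: (enum 'I_n) st => //= t ts IH st.
  by case: ifP => //= t_h; rewrite IH eq_zw.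
case: h ext => ext; [left | right]; apply: ext => t.
  by move/eqP; exact: eq_zx.
by rewrite eqbF_neg -leqNgt; exact: eq_zy.
Qed.
End Run.

(** * From type 1 orders to the space bound *)

Lemma type1_interleaved (n m : nat) (pi : 'S_n) : type1_order pi m ->
  exists (a b : 'I_m -> 'I_n) (T : nat),
    [/\ interleaved a b, forall (t : 'I_n) k, t < T -> b k != pi t
      & forall (t : 'I_n) k, T <= t -> a k != pi t].
Proof.
case=> I [J [i [j [[-> ->] _ i_lt_j [ij ji j_last]]]]].
(* [T] is the time just after the last element of I, hence no later than any element of J. *)
exists (fun k => pi (i k)), (fun k => pi (j k)), (\max_k (i k).+1); split.
(* Induction on l - k: the chain relates consecutive blocks only, so pass through the predecessor of
   l. *)
- split=> // k l; have [c] := ubnP (l - k); elim: c l => // c IH l le_c lt_kl.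
  have l_pred : l.-1 < m by have := ltn_ord l; lia.
  pose l' := Ordinal l_pred; have jl : pi (j l') < pi (i l).
    by apply: ji => /=; lia.
  have [eq_kl|lt_kl'] := leqP l' k.
    by rewrite (_ : k = l') //; apply/val_inj => /=; move: eq_kl => /=; lia.
  have := IH l' _ lt_kl'; have := ij l' => /=; lia.
- move=> t k lt_tT; apply/eqP => /perm_inj eq_t; move: lt_tT.
  rewrite ltnNge -eq_t => /negP; apply; apply/bigmax_leqP => l _.
  by apply: i_lt_j; apply: imset_f.
move=> t k le_Tt; apply/eqP => /perm_inj eq_t.
by have := @leq_bigmax 'I_m (fun k => (i k).+1) k; rewrite leqNgt eq_t ltnS le_Tt.
Qed.

Local Open Scope ring_scope.

(** A common answer is at most 33/32 of [L1] and at least 32/33 of [L2]. *)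
Lemma mult_approx_ratio (K : realFieldType) (v : K) (L1 L2 : nat) :
    mult_approx (1 + 1 / 32%:R) v L1%:R -> mult_approx (1 + 1 / 32%:R) v L2%:R ->
  (32 * 32 * L2 <= 33 * 33 * L1)%N.
Proof.
move=> /andP[_ v_le] /andP[v_ge _].
rewrite ler_pdivrMr in v_ge; last by lra.
by rewrite -(ler_nat K) !natrM; lra.
Qed.

Theorem theorem2 (K : realFieldType) :
  exists c : K, 0 < c /\
    forall (n m R s : nat) (d : Order.disp_t) (Sigma : orderType d)
           (pi : 'S_n) (A : streaming_alg K Sigma n R s),
      card_gt Sigma n ->
      type1_order pi m ->
      (0 < R)%N ->
      (forall x : n.-tuple Sigma,
          mult_approx (1 + 1 / 32%:R) (alg_result A pi x) (LIS x)%:R) ->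
      c * (m%:R / R%:R) <= s%:R.
Proof.
(* 24 = 12 * 2: the 12 of [exponent_of_ball_bound], with [q] = 2Rs. *)
exists (1 / 24%:R); split=> [|n m R s d Sigma pi A [e0 [e0_uniq ltn_e]]]; first by lra.
move=> /type1_interleaved[a [b [T [ab bob_late alice_early]]]] R_gt0 approx.
suff le_m : (m <= 24 * (s * R))%N.
  rewrite mulrA ler_pdivrMr ?ltr0n // -natrM.
  by rewrite -(ler_nat K) natrM in le_m; lra.
have [->//|m_gt0] := posnP m.
have n_gt0 : (0 < n)%N by case: ab => _ _ /(_ (Ordinal m_gt0)); lia.
pose e := sort <=%O e0.
have e_sorted : sorted <%O e by rewrite sort_lt_sorted.
have ltne : (n < size e)%N by rewrite size_sort.
case De: e => [|z0 e']; first by rewrite De in ltne.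
pose x := hard_input z0 e a b.
pose tr u := Tuple (size_transcript A pi T (x u u)).
have gap u v : tr u = tr v -> (32 * 32 * (m + #|v :\: u|).+1 <= 33 * 33 * m.+1)%N.
  move=> /(congr1 val) /= eq_tr.
  have eq_res : alg_result A pi (x u v) = alg_result A pi (x u u).
    apply: alg_result_mix eq_tr => t le_t; rewrite !tnth_mktuple; congr nth.
      by apply: hard_index_alice => k; exact: bob_late.
    by apply: hard_index_bob => k; exact: alice_early.
  have := approx (x u v); rewrite eq_res => /(mult_approx_ratio (approx (x u u))) ratio.
  apply: leq_trans (leq_trans ratio (leq_mul (leqnn _) _)).
    by rewrite leq_mul // LIS_hard_input_ge.
  exact: LIS_hard_input_diag.
have dist u v : tr u = tr v -> (#|u :\: v| + #|v :\: u| <= m %/ 4)%N.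
  (* As 33^2 - 32^2 = 65, each difference has at most 65(m + 1)/1024 elements. Integrality makes
     both empty for m < 15, which covers small m where [m %/ 4] is 0. *)
  by move=> eq_tr; have := gap u v eq_tr; have := gap v u (esym eq_tr); lia.
have := small_fibers_card dist.
rewrite card_ord !card_tuple card_bool -expnM => /exponent_of_ball_bound; lia.
Qed.
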